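(* Let $q\ge 0$. The homology of the complex $(\mathfrak{A}_q,d)$ is generated by the set of homology classes of the elements $a_S\in A_{k,q+k}$ (regarded as elements of the direct limit $\mathfrak{A}_q$), with $q\le k-1$ and $S$ a set of $k$-element subsets of $[q+k]$, such that for some choice of a set $\mathcal{P}(S)$ $$\bigcup S=\mathcal{P}(S)\cup\Big(\bigcup_{\sigma\in S}\mathcal{F}(\sigma)\Big)$$ and $|\mathcal{F}(\sigma)|=1$ for all $\sigma\in S$.
   Context: All vector spaces are over $\mathbb{Q}$. Write $[\ell]=\{1,\dots,\ell\}$. For $\ell\ge k\ge 2$ and $\sigma\subset[\ell]$ with $|\sigma|=k$ let $X(\sigma)=\{v\in\mathbb{C}^\ell : v_i=v_j \text{ for all } i,j\in\sigma\}$; these subspaces form the $k$-equal arrangement $\mathcal{A}_{k,\ell}$, and its atoms are identified with the $k$-subsets $\sigma$ of $[\ell]$. For a set $S$ of $k$-subsets of $[\ell]$ put $X(S)=\bigcap_{\sigma\in S}X(\sigma)$ (with $X(\emptyset)=\mathbb{C}^\ell$). The relative atomic complex $A_{k,\ell}$ has basis $\{a_S\}$, one generator for each set $S$ of $k$-subsets of $[\ell]$, and differential $d a_S=\sum(-1)^j a_{S\setminus\{\sigma_j\}}$, where $S=\{\sigma_1<\dots<\sigma_r\}$ in a fixed linear order on the atoms and the sum is over those $j$ with $X(S\setminus\{\sigma_j\})=X(S)$. Complement notation: if $\Lambda=\{[\ell]\setminus\sigma : \sigma\in S\}$, write $b_\Lambda=a_S$. Multiplication by $\mathcal{A}_{1,1}$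 gives maps $A_{k,\ell}\to A_{k+1,\ell+1}$ sending $a_S$ to $a_{S'}$ with $S'=\{\sigma\cup\{\ell+1\}:\sigma\in S\}$; in complement notation $b_\Lambda\mapsto b_\Lambda$. For fixed $q$, $\mathfrak{A}_q$ is the direct limit of the system $A_{2,q+2}\to A_{3,q+3}\to\cdots\to A_{k,q+k}\to\cdots$; it has basis the elements $b_\Lambda$ with $\Lambda$ a finite set of $q$-element subsets of $\mathbb{Z}_{>0}$. Its differential is $d(b_\Lambda)=\sum(-1)^j b_{\Lambda\setminus\{\lambda_j\}}$, where $\Lambda=\{\lambda_1<\dots<\lambda_r\}$ in a fixed linear order (compatible with the maps of the system, e.g. lexicographic) and the sum is over all $\lambda_j\in\Lambda$ with $\bigcap\Lambda=\bigcap(\Lambda\setminus\{\lambda_j\})$; when $\Lambda$ has one element no term appears (consistent with $X(\emptyset)$ being the whole space). For a set $S$ of $k$-subsets of $[q+k]$ and $\sigma\in S$, $\mathcal{F}(\sigma)$ is the set of $i\in\sigma$ that are not contained in any $\tau\in S\setminus\{\sigma\}$. Write $\bigcup S$ and $\bigcap S$ for the union and intersection of the members of $S$. A set $\mathcal{P}(S)$ is a subset of $\bigcup S$ such that: (i) $|\mathcal{P}(S)|=k-1$; (ii) $\bigcap S\subset\mathcal{P}(S)$; (iii) $\mathcal{F}(\sigma)\setminus(\mathcal{P}(S)\cap\mathcal{F}(\sigma))$ is non-empty for every $\sigma\in S$. There may be several such sets or none.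
   Formalization: The elements a_S with |S| ≤ 1 are added to the generators: they are cycles with non-zero classes, but the conditions on P(S) and F(σ) force |S| ≥ 2, so the claim fails without them; for |S| ≥ 2 the generators are exactly those stated. *)

(* Defs.v *)
From HB Require Import structures.
From mathcomp Require Export all_boot all_order all_algebra.
From mathcomp Require Export finmap.
From mathcomp.multinomials Require Export monalg.

Set Implicit Arguments.
Unset Strict Implicit.
Unset Printing Implicit Defensive.

Import GRing.Theory.
Local Open Scope fset_scope.
Local Open Scope ring_scope.

(* The q-element subsets of the positive integers. *)
Record qset (q : nat) := QSet {
  qset_val :> {fset nat};
  _ : (#|` qset_val| == q) && (0%N \notin qset_val) }.
HB.instance Definition _ q := [isSub for @qset_val q].
HB.instance Definition _ q := [Choice of qset q by <:].

(* The k-element subsets of [n]; the ordinal i : 'I_n stands for i + 1. *)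
Record kset (k n : nat) := KSet {
  kset_val :> {set 'I_n};
  _ : #|kset_val| == k }.
HB.instance Definition _ k n := [isSub for @kset_val k n].
HB.instance Definition _ k n := [Finite of kset k n by <:].

(* The rational vector space with basis the b_L, L a finite set of qsets; the
   basis element b_L is << L >>. *)
Notation frakA q := {malg rat[{fset qset q}]}.

(* The intersection of the members of L, for L nonempty. For L empty, where the
   intersection is all of Z_{>0}, this is a junk value, which the guard in
   [removable] excludes. *)
Definition inter (q : nat) (L : {fset qset q}) : {fset nat} :=
  [fset i in \bigcup_(l <- L) (l : {fset nat}) | all (fun l : qset q => i \in (l : {fset nat})) L].

Definition removable (q : nat) (L : {fset qset q}) (l : qset q) : bool :=
  (L `\ l != fset0) && (inter (L `\ l) == inter L).

(* The position j, counted from 1, of l in L. *)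
Definition pos (q : nat) (le : rel (qset q)) (L : {fset qset q}) (l : qset q) : nat :=
  #|` [fset m in L | le m l]|.

Definition bdiff (q : nat) (le : rel (qset q)) (L : {fset qset q}) : frakA q :=
  \sum_(l <- L | removable L l)
     (-1) ^+ pos le L l *: << L `\ l >>.

Definition diff (q : nat) (le : rel (qset q)) (z : frakA q) : frakA q :=
  \sum_(L <- msupp z) z@_L *: bdiff le L.

Lemma diff_is_linear q le : linear (@diff q le).
Proof.
have E (z : frakA q) (D : {fset {fset qset q}}) : msupp z `<=` D ->
    diff le z = \sum_(L <- D) z@_L *: bdiff le L.
  move=> sD; rewrite /diff (big_fset_incl _ sD) // => L _ /mcoeff_outdom ->.
  by rewrite scale0r.
move=> c x y; pose D := msupp x `|` msupp y `|` msupp (c *: x + y).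
rewrite (E x D) ?(E y D) ?(E _ D) ?fsubsetUr //; first last.
- by rewrite /D -fsetUA fsubsetUl.
- by rewrite /D fsetUAC fsubsetUr.
rewrite scaler_sumr -big_split /=; apply: eq_bigr => L _.
by rewrite mcoeffD mcoeffZ scalerDl scalerA.
Qed.

HB.instance Definition _ q le :=
  GRing.isLinear.Build rat (frakA q) (frakA q) _ (@diff q le)
    (@diff_is_linear q le).


Lemma diffU q (le : rel (qset q)) L : diff le << L >> = bdiff le L.
Proof.
by rewrite /diff msuppU oner_eq0 big_seq_fset1 mcoeffUU scale1r.
Qed.

Lemma inter_in q (L : {fset qset q}) l i : l \in L ->
  (i \in inter L) = all (fun m : qset q => i \in (m : {fset nat})) L.
Proof.
move=> Ll; rewrite /inter !inE; case: allP => [h|_]; last by rewrite andbF.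
by rewrite andbT; apply/bigfcupP; exists l; rewrite ?Ll ?h.
Qed.

Lemma interS q (L M : {fset qset q}) :
  M != fset0 -> M `<=` L -> inter L `<=` inter M.
Proof.
case/fset0Pn=> l Ml /fsubsetP sML; apply/fsubsetP=> i.
rewrite (inter_in _ Ml) (inter_in _ (sML _ Ml)) => /allP h.
by apply/allP => m /sML /h.
Qed.

(* In the next proofs D abbreviates deletion: conversion of nested terms
   L `\ l `\ m is very slow. *)
Lemma removable2 q (D : {fset qset q} -> qset q -> {fset qset q}) L l m :
  (forall M x, D M x = M `\ x) ->
  removable L l && removable (D L l) m =
  (D (D L l) m != fset0) && (inter (D (D L l) m) == inter L).
Proof.
move=> DE.
have rE M x : removable M x = (D M x != fset0) && (inter (D M x) == inter M).
  by rewrite DE.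
have sD M x : D M x `<=` M by rewrite DE fsubD1set.
have D0 x : D fset0 x = fset0 by rewrite DE fset0D.
rewrite !rE; move: (sD L l) (sD (D L l) m) (D0 m); clear rE sD D0 DE.
move: (D L l) => L1; have [-> _ _ ->|L1n0] := eqVneq L1 fset0.
  by rewrite eqxx.
move: (D L1 m) => L2 s1 s2 _; have [//|L2n0] := eqVneq L2 fset0.
  by rewrite andbF.
have h1 := interS L1n0 s1; have h2 := interS L2n0 s2.
move: (inter L) (inter L1) (inter L2) h1 h2 => i0 i1 i2 h1 h2 /=.
apply/andP/eqP => [[/eqP <- /eqP //]|E]; rewrite E in h2 *.
suff -> : i1 = i0 by rewrite eqxx.
by apply/eqP; rewrite eqEfsubset h1 h2.
Qed.

Lemma diff_diff q (le : rel (qset q)) :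
  total le -> antisymmetric le -> forall z, diff le (diff le z) = 0.
Proof.
move=> tot asym z.
have E z' : diff le z' = \sum_(L <- msupp z') z'@_L *: bdiff le L by [].
rewrite (E z) linear_sum big1 // => L _ /=; rewrite linearZ /=.
suff -> : diff le (bdiff le L) = 0 by rewrite scaler0.
have [p pE] : {p | pos le = p} by exists (pos le).
have pD M l m : l \in M -> p M m = (le l m + p (M `\ l) m)%N.
  move=> Ml; rewrite -pE /pos (cardfsD1 l) !inE /= Ml /=; congr (_ + #|` _|)%N.
  by apply/fsetP => i; rewrite !inE /= andbA.
have [D DE] : {D : {fset qset q} -> qset q -> {fset qset q} |
    forall M x, D M x = M `\ x} by exists (fun M x => M `\ x).
have DC l m : D (D L m) l = D (D L l) m by rewrite !DE 2!fsetDDl fsetUC.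
have {}pD M l m : l \in M -> p M m = (le l m + p (D M l) m)%N.
  by move=> Ml; rewrite DE (pD M l).
have bE M : bdiff le M =
    \sum_(x <- M) if removable M x then (-1) ^+ p M x *: << D M x >> else 0.
  by rewrite /bdiff pE big_mkcond; apply: eq_bigr => x _; rewrite DE.
have rC l m : removable L l && removable (D L l) m =
    removable L m && removable (D L m) l.
  have r1 := removable2 L l m DE; have r2 := removable2 L m l DE.
  pose G (X : {fset qset q}) := (X != fset0) && (inter X == inter L).
  have e : G (D (D L l) m) = G (D (D L m) l) := congr1 G (DC m l).
  exact: (eq_trans r1 (eq_trans e (esym r2))).
have inD l m : m \in D L l = (m != l) && (m \in L) by rewrite DE !inE.
have DS l (G : qset q -> frakA q) : l \in L ->
    \sum_(m <- L) G m = G l + \sum_(m <- D L l) G m.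
  by move=> Ll; rewrite (big_fsetD1 l) //= DE.
clear DE; move: (@removable q) bE rC => rm bE rC.
pose c l m := [&& l != m, rm L l & rm (D L l) m].
pose F l m : frakA q :=
  if c l m then (-1) ^+ (p L l + p (D L l) m) *: << D (D L l) m >> else 0.
have cC l m : c l m = c m l.
  by rewrite /c rC (eq_sym l m).
have FN l m : l \in L -> m \in L -> F l m = - F m l.
  move=> Ll Lm; rewrite /F cC DC; case clm: (c m l); last by rewrite oppr0.
  rewrite -scaleNr; congr (_ *: _).
  rewrite (pD L m l) // (pD L l m) //.
  have nml : m != l by case/and3P: clm.
  have := tot l m; have := asym l m.
  case: (le l m); case: (le m l) => //=; rewrite ?add0n ?add1n => h _.
  - by case/eqP: nml; rewrite h.
  - by rewrite addSn addnC exprS mulN1r opprK.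
  - by rewrite addSn addnC exprS mulN1r.
have S : diff le (bdiff le L) = \sum_(l <- L) \sum_(m <- L) F l m.
  rewrite bE linear_sum big_seq [RHS]big_seq; apply: eq_bigr => l Ll /=.
  rewrite (DS l) // {1}/F {1}/c eqxx add0r.
  case rl: (rm L l); last first.
    by rewrite linear0 big1 // => m _; rewrite /F /c rl andbF.
  rewrite linearZ /= diffU bE scaler_sumr big_seq [RHS]big_seq.
  apply: eq_bigr => m; rewrite inD => /andP[nml Lm].
  rewrite /F /c rl eq_sym nml /=.
  by case: (rm _ m); [rewrite scalerA exprD | rewrite scaler0].
have TN : diff le (bdiff le L) = - diff le (bdiff le L).
  rewrite {1}S exchange_big S -sumrN big_seq [RHS]big_seq /=.
  apply: eq_bigr => l Ll; rewrite -sumrN big_seq [RHS]big_seq.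
  by apply: eq_bigr => m Lm; rewrite FN.
apply/malgP => M; move/(congr1 (mcoeff M)): TN.
rewrite mcoeffN mcoeff0 => /eqP; rewrite -addr_eq0 -mulr2n -mulr_natl mulf_eq0 /=.
by move/eqP.
Qed.

Definition compl_fset n (A : {set 'I_n}) : {fset nat} :=
  [fset (val i).+1 | i in ~: A].

Lemma compl_subproof q k (s : kset k (q + k)) :
  (#|` compl_fset s| == q) && (0%N \notin compl_fset s).
Proof.
apply/andP; split; last by apply/imfsetP => -[].
rewrite card_imfset /=; last by move=> i j [/val_inj].
by rewrite -cardE cardsCs setCK card_ord (eqP (valP s)) addnK.
Qed.

Definition compl q k (s : kset k (q + k)) : qset q := QSet (compl_subproof s).

(* The image in the direct limit of the generator a_S of A_{k,q+k}. *)
Definition aS q k (S : {set kset k (q + k)}) : frakA q :=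
  << [fset compl s | s in S] >>.

Section Hypergraph.
Variables k n : nat.
Implicit Types S : {set kset k n}.
Local Open Scope set_scope.

Definition freeElts S (s : kset k n) : {set 'I_n} :=
  [set i in (s : {set 'I_n}) |
     [forall t in S :\ s, i \notin (t : {set 'I_n})]].

Definition isP S (P : {set 'I_n}) : Prop :=
  [/\ P \subset \bigcup_(s in S) (s : {set 'I_n}),
      #|P| = k.-1,
      \bigcap_(s in S) (s : {set 'I_n}) \subset P
    & forall s, s \in S ->
        freeElts S s :\: (P :&: freeElts S s) != set0].

Definition Pgenerator S : Prop :=
  (exists2 P : {set 'I_n}, isP S P
     & \bigcup_(s in S) (s : {set 'I_n}) =
         P :|: \bigcup_(s in S) freeElts S s)
  /\ (forall s, s \in S -> #|freeElts S s| = 1%N).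

End Hypergraph.

(* The homology ker d / im d is spanned by the classes of the elements of G:
   these are cycles, and every cycle is a linear combination of them modulo a
   boundary. *)
Definition homology_generated_by (R : nzRingType) (V : lmodType R)
    (d : V -> V) (G : V -> Prop) : Prop :=
  (forall g, G g -> d g = 0) /\
  (forall z, d z = 0 ->
     exists (m : nat) (c : 'I_m -> R) (g : 'I_m -> V),
       (forall i, G (g i)) /\ exists w, z = \sum_(i < m) c i *: g i + d w).

Lemma Pgenerator_card k n (S : {set kset k n}) :
  (2 <= k)%N -> Pgenerator S -> (1 < #|S|)%N.
Proof.
move=> k2 [[P [PS cP _ _] _] F1]; rewrite ltnNge; apply/negP => S1.
have [S0|/set0Pn[s Ss]] := eqVneq S set0.
  by move: PS cP k2; rewrite S0 big_set0 subset0 => /eqP ->; rewrite cards0; case: k {S P F1 S0 S1} => [|[]].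
have Es : S = [set s].
  by apply/eqP; rewrite eq_sym eqEcard sub1set Ss cards1.
have := F1 s Ss; suff -> : freeElts S s = s.
  by rewrite (eqP (valP s)) => k1; rewrite k1 in k2.
apply/setP => i; rewrite inE Es; case: (_ \in _) => //=.
by apply/forallP => t; rewrite !inE; case: (t == s).
Qed.

Lemma diff_small q (le : rel (qset q)) (w : frakA q) (M : {fset qset q}) :
  (#|` M| <= 1)%N -> (diff le w)@_M = 0.
Proof.
move=> M1; rewrite /diff raddf_sum big1 // => L _ /=; rewrite mcoeffZ.
rewrite /bdiff raddf_sum big_seq_cond big1 ?mulr0 // => l /andP[Ll] /=.
rewrite mcoeffZ mcoeffU; case: eqVneq => [E|_ _]; last by rewrite mulr0.
rewrite /removable E => /andP[/fset0Pn[m Mm] /eqP I].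
have EM : M = [fset m].
  by apply/eqP; rewrite eq_sym eqEfcard fsub1set Mm cardfs1.
have Lm : m \in L by move: Mm; rewrite -E !inE => /andP[].
have sml : (m : {fset nat}) `<=` l.
  apply/fsubsetP => i im; have : i \in inter M.
    by rewrite (inter_in _ Mm) EM; apply/allP => x /fset1P ->.
  by rewrite I (inter_in _ Ll) => /allP/(_ _ Ll).
have eml : m = l.
  apply/val_inj/eqP; rewrite eqEfcard sml /=.
  by case/andP: (valP m) (valP l) => /eqP -> _ /andP[/eqP -> _].
by move: Mm; rewrite -E eml !inE eqxx.
Qed.

(* The classes of b_L with L empty or a singleton are never combinations of the
   classes of the elements a_S with Pgenerator S, so these have to be added as
   degenerate generators. *)
Lemma small_not_Pgenerated q (le : rel (qset q)) (M : {fset qset q}) :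
  (#|` M| <= 1)%N ->
  ~ exists (m : nat) (c : 'I_m -> rat) (g : 'I_m -> frakA q),
      (forall i, exists k (S : {set kset k (q + k)}),
         [/\ (2 <= k)%N, (q <= k - 1)%N, Pgenerator S & g i = aS S])
      /\ exists w, << M >> = \sum_(i < m) c i *: g i + diff le w.
Proof.
move=> M1 [m [c [g [hg [w /(congr1 (mcoeff M))]]]]].
rewrite mcoeffUU mcoeffD diff_small // addr0 raddf_sum big1 => [/eqP|i _] /=.
  by rewrite oner_eq0.
have [k [S [k2 _ /(Pgenerator_card k2) S1 ->]]] := hg i.
rewrite mcoeffZ /aS mcoeffU; case: eqVneq => [E|_]; last by rewrite mulr0.
move: M1; rewrite -E card_imfset /=; last first.
  move=> s t /(congr1 (@qset_val q)) /= /fsetP h; apply/val_inj/setP => i0.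
  have mem (u : kset k (q + k)) :
      ((i0 : nat).+1 \in compl_fset u) = (i0 \notin (u : {set 'I_(q + k)})).
    apply/imfsetP/idP => [[j]|h0]; last by exists i0; rewrite ?inE.
    by rewrite /= inE => nj [/val_inj ->].
  by have := h (i0 : nat).+1; rewrite !mem => /negb_inj.
by rewrite -cardE leqNgt S1.
Qed.

(* Main.v *)
From HB Require Import structures.
Require Import Defs.
From mathcomp Require Import zify.

(** Fix [J] with [#|J| < q] and split off the part of the complex spanned by the
    [b_L] with [\bigcap L = J]. It is the simplex [D] on all q-sets containing
    [J] modulo the subcomplex [K] of those [L] whose members share an element
    outside [J]. As [D] is contractible, the homology of this part is that of
    [K], and [K] is covered by the simplices on the q-sets containing [J + i],
    whose nerve is a skeleton of a simplex. Running Mayer-Vietoris by hand, one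
    element [i] at a time, shows that every cycle of [K] becomes a boundary once
    the faces [{l | J <= l <= U}] with [#|U| = q + 1] are adjoined. These faces
    are the [b_L] that come from the [a_S] of the statement: [F(U - f) = {f}],
    and the only candidate for [P(S)] is the complement of [U]. *)

Set Implicit Arguments.
Unset Strict Implicit.
Unset Printing Implicit Defensive.

Import GRing.Theory.
Local Open Scope fset_scope.
Local Open Scope ring_scope.

(** * Rational chains with prescribed support *)

Section Chains.
Variable T : choiceType.
Implicit Types (z : {malg rat[T]}) (P Q : T -> Prop).

Definition supported P z := forall x, z@_x != 0 -> P x.

Lemma supported_ind P (W : {malg rat[T]} -> Prop) z :
  W 0 -> (forall c x y, P x -> W y -> W (c *: << x >> + y)) ->
  supported P z -> W z.
Proof.
move=> W0 WD Pz; rewrite [z]monalgE big_seq; elim/big_rec: _ => // x y xz Wy.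
have -> : << z@_x *g x >> = z@_x *: << x >>.
  by apply/malgP => k; rewrite mcoeffZ !mcoeffU mulrnAr mulr1.
by apply: WD => //; apply: Pz; rewrite mcoeff_neq0.
Qed.

Lemma supported0 P : supported P 0.
Proof. by move=> x; rewrite mcoeff0 eqxx. Qed.

Lemma supportedD P y z : supported P y -> supported P z -> supported P (y + z).
Proof.
move=> Py Pz x; rewrite mcoeffD.
by have [->|/Py//] := eqVneq (y@_x) 0; rewrite add0r => /Pz.
Qed.

Lemma supportedZ P c z : supported P z -> supported P (c *: z).
Proof.
by move=> Pz x; rewrite mcoeffZ mulf_eq0 negb_or => /andP[_ /Pz].
Qed.

Lemma supportedB P y z : supported P y -> supported P z -> supported P (y - z).
Proof.
by move=> Py Pz; rewrite -scaleN1r; apply: supportedD => //; exact: supportedZ.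
Qed.

Lemma supportedU P x : P x -> supported P << x >>.
Proof.
move=> Px y; rewrite mcoeffU; have [<- //|_] := eqVneq x y.
by rewrite mulr0n eqxx.
Qed.

Lemma supportedZU P c x : P x -> supported P (c *: << x >>).
Proof. by move=> Px; apply: supportedZ; exact: supportedU. Qed.

Lemma supported_sub P Q z : (forall x, P x -> Q x) -> supported P z -> supported Q z.
Proof. by move=> PQ Pz x /Pz/PQ. Qed.

Lemma supported_sum P (I : Type) (r : seq I) (p : pred I) (F : I -> {malg rat[T]}) :
  (forall i, p i -> supported P (F i)) -> supported P (\sum_(i <- r | p i) F i).
Proof.
by move=> PF; elim/big_ind: _ => // [|y z]; [apply: supported0|apply: supportedD].
Qed.

Lemma supportedT z : supported (fun=> True) z.
Proof. by []. Qed.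

Lemma supported_split P Q z : supported (fun x => P x \/ Q x) z ->
  exists y w, [/\ supported P y, supported Q w & z = y + w].
Proof.
elim/supported_ind => [|c x t PQ [y [w [Py Qw ->]]]].
  by exists 0, 0; split; rewrite ?addr0 //; exact: supported0.
case: PQ => [Px|Qx].
  exists (c *: << x >> + y), w; split=> //; last by rewrite addrA.
  by apply: supportedD => //; apply: supportedZU.
exists y, (c *: << x >> + w); split=> //; last by rewrite addrCA.
by apply: supportedD => //; apply: supportedZU.
Qed.

Definition linext (V : lmodType rat) (f : T -> V) z : V :=
  \sum_(x <- msupp z) z@_x *: f x.

Lemma linext_is_linear (V : lmodType rat) (f : T -> V) : linear (linext f).
Proof.
have E z (D : {fset T}) : msupp z `<=` D -> linext f z = \sum_(x <- D) z@_x *: f x.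
  move=> sD; rewrite /linext (big_fset_incl _ sD) // => x _ /mcoeff_outdom ->.
  by rewrite scale0r.
move=> c y z; pose D := msupp y `|` msupp z `|` msupp (c *: y + z).
rewrite (E y D) ?(E z D) ?(E _ D) ?fsubsetUr //; first last.
- by rewrite /D -fsetUA fsubsetUl.
- by rewrite /D fsetUAC fsubsetUr.
rewrite scaler_sumr -big_split /=; apply: eq_bigr => x _.
by rewrite mcoeffD mcoeffZ scalerDl scalerA.
Qed.

HB.instance Definition _ (V : lmodType rat) (f : T -> V) :=
  GRing.isLinear.Build rat {malg rat[T]} V _ (@linext V f) (linext_is_linear f).

Lemma linextU (V : lmodType rat) (f : T -> V) x : linext f << x >> = f x.
Proof.
by rewrite /linext msuppU oner_eq0 big_seq_fset1 mcoeffUU scale1r.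
Qed.

Lemma supported_linear P Q (d : {linear {malg rat[T]} -> {malg rat[T]}}) z :
  (forall x, P x -> supported Q (d << x >>)) ->
  supported P z -> supported Q (d z).
Proof.
move=> PQ; elim/supported_ind => [|c x y Px Qy].
  by rewrite linear0; exact: supported0.
by rewrite linearP; apply: supportedD => //; apply: supportedZ; exact: PQ.
Qed.

Lemma eq_linear_supported (V : lmodType rat) P (f g : {linear {malg rat[T]} -> V}) z :
  (forall x, P x -> f << x >> = g << x >>) -> supported P z -> f z = g z.
Proof.
move=> fg; elim/supported_ind => [|c x y Px E]; first by rewrite !linear0.
by rewrite !linearP E fg.
Qed.

(** By linearity, corrections found face by face add up to a correction of the whole chain. It
    serves to push chains into a smaller family of faces modulo boundaries. *)
Lemma reduce_supported P P' Q (d : {linear {malg rat[T]} -> {malg rat[T]}}) z :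
  (forall x, P x -> exists2 w, supported P' w & supported Q (<< x >> - d w)) ->
  supported P z -> exists2 w, supported P' w & supported Q (z - d w).
Proof.
move=> H; elim/supported_ind => [|c x y Px [w Pw Qw]].
  by exists 0; [|rewrite linear0 subr0]; apply: supported0.
have [v Pv Qv] := H x Px; exists (c *: v + w).
  by apply: supportedD => //; apply: supportedZ.
rewrite linearP opprD addrACA -scalerBr.
by apply: supportedD => //; apply: supportedZ.
Qed.

End Chains.

(** * The augmented boundary of a simplex, and cones *)

Section Boundary.
Variables (T : choiceType) (le : rel T).
Hypotheses (le_total : total le) (le_asym : antisymmetric le).
Implicit Types (L M : {fset T}) (l m : T) (z : {malg rat[{fset T}]}).
Notation chain := {malg rat[{fset T}]}.

Definition rank L l : nat := #|` [fset m in L | le m l]|.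

(** This is the augmented simplicial boundary: a vertex is sent, up to sign, to the empty face.
    Unlike in [bdiff], every vertex may be deleted, whatever happens to the intersection. *)
Definition face_sum L : chain := \sum_(l <- L) (-1) ^+ rank L l *: << L `\ l >>.

Definition bd : {linear chain -> chain} := linext face_sum.

Lemma bdU L : bd << L >> = face_sum L. Proof. exact: linextU. Qed.

Lemma rankD1 L l m : l \in L -> rank L m = (le l m + rank (L `\ l) m)%N.
Proof.
move=> Ll; rewrite /rank (cardfsD1 l) !inE /= Ll /=; congr (_ + #|` _|)%N.
by apply/fsetP => i; rewrite !inE /= andbA.
Qed.

Lemma supported_bdU (P : {fset T} -> Prop) L :
  (forall l, l \in L -> P (L `\ l)) -> supported P (bd << L >>).
Proof.
move=> H; rewrite bdU /face_sum big_seq; apply: supported_sum => l Ll.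
by apply: supportedZU; exact: H.
Qed.

Lemma bd_bd z : bd (bd z) = 0.
Proof.
suff E : forall L, bd (bd << L >>) = 0.
  have := @supportedT _ z; elim/supported_ind => [|c L y _ IH].
    by rewrite !linear0.
  by rewrite !linearP IH E scaler0 addr0.
(* [F l m] is the contribution of deleting first [l] and then [m]. Swapping the two flips the sign,
   so the double sum is its own negative and vanishes over the rationals. *)
move=> L; pose F l m : chain := if l == m then 0 else
  (-1) ^+ (rank L l + rank (L `\ l) m) *: << L `\ l `\ m >>.
have S : bd (bd << L >>) = \sum_(l <- L) \sum_(m <- L) F l m.
  rewrite bdU linear_sum big_seq [RHS]big_seq; apply: eq_bigr => l Ll /=.
  rewrite linearZ /= bdU /face_sum (big_fsetD1 l Ll) /= {1}/F eqxx add0r scaler_sumr.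
  rewrite big_seq [RHS]big_seq; apply: eq_bigr => m.
  by rewrite /F !inE eq_sym => /andP[/negPf -> _]; rewrite scalerA exprD.
have FN l m : l \in L -> m \in L -> F l m = - F m l.
  move=> Ll Lm; rewrite /F (eq_sym m l); case: eqVneq => [_|nlm]; first by rewrite oppr0.
  have -> : L `\ m `\ l = L `\ l `\ m by rewrite 2!fsetDDl fsetUC.
  rewrite -scaleNr; congr (_ *: _).
  rewrite (rankD1 l Lm) (rankD1 m Ll).
  have := le_total l m; have := @le_asym l m.
  case: (le l m); case: (le m l) => //=; rewrite ?add0n ?add1n => h _.
  - by case/eqP: nlm; rewrite h.
  - by rewrite addSn addnC exprS mulN1r opprK.
  - by rewrite addSn addnC exprS mulN1r.
have TN : bd (bd << L >>) = - bd (bd << L >>).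
  rewrite {1}S exchange_big S -sumrN big_seq [RHS]big_seq /=.
  apply: eq_bigr => l Ll; rewrite -sumrN big_seq [RHS]big_seq.
  by apply: eq_bigr => m Lm; rewrite FN.
apply/malgP => M; move/(congr1 (mcoeff M)): TN.
rewrite mcoeffN mcoeff0 => /eqP; rewrite -addr_eq0 -mulr2n -mulr_natl mulf_eq0 /=.
by move/eqP.
Qed.

(** The facet opposite [l] has a sign as its coefficient in the boundary of [L]. Scaling by this
    sign trades the facet for the other facets of [L]. *)
Lemma face_bd L l : l \in L -> exists c : rat,
  supported (fun M => exists2 m, m \in L `\ l & M = L `\ m)
    (<< L `\ l >> - bd (c *: << L >>)).
Proof.
move=> Ll; exists ((-1) ^+ rank L l).
rewrite linearZ /= bdU /face_sum (big_fsetD1 l Ll) /=.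
rewrite scalerDr scalerA -expr2 sqrr_sign scale1r.
rewrite opprD addrA subrr add0r -scaleNr; apply: supportedZ.
rewrite big_seq; apply: supported_sum => m Lm.
by apply: supportedZU; exists m.
Qed.

(* Modulo boundaries every face can be made to contain [l]; a cycle all of whose
   faces contain [l] vanishes, since [L] is recovered from [L `\ l]. *)
Lemma cone_acyclic (P : pred T) l z : P l ->
  supported (fun L => {in L, forall x, P x}) z -> bd z = 0 ->
  exists2 w, supported (fun L => {in L, forall x, P x}) w & z = bd w.
Proof.
move=> Pl Pz dz.
have [|w Pw Qw] := @reduce_supported _ _ (fun L => {in L, forall x, P x})
    (fun L => l \in L) bd z _ Pz.
  move=> L PL; have [lL|nlL] := boolP (l \in L).
    by exists 0; [exact: supported0|rewrite linear0 subr0; apply: supportedU].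
  have lM : l \in l |` L by rewrite fset1U1.
  have EM : (l |` L) `\ l = L by rewrite fsetU1K.
  have [c Hc] := face_bd lM; exists (c *: << l |` L >>).
    apply: supportedZU => x; rewrite !inE => /orP[/eqP ->//|/PL//].
  rewrite EM in Hc; apply: supported_sub Hc => M [m mL ->].
  by rewrite !inE eqxx andbT; apply: contraNneq nlL => ->.
exists w => //; apply/eqP; rewrite -subr_eq0; apply/eqP.
have: bd (z - bd w) = 0 by rewrite linearB dz bd_bd subrr.
move: (z - bd w) Qw => {dz w Pw Pz} {}z Qz dz.
apply/malgP => L; rewrite mcoeff0; apply/eqP/negPn/negP => zL.
have lL := Qz L zL.
have E : (bd z)@_(L `\ l) = (-1) ^+ rank L l * z@_L.
  have H : supported (fun L => l \in L) z ->
      (bd z)@_(L `\ l) = (-1) ^+ rank L l * z@_L.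
    elim/supported_ind => [|c M y lM IH].
      by rewrite linear0 !mcoeff0 mulr0.
    rewrite linearP !mcoeffD !mcoeffZ IH mulrDr; congr (_ + _).
    rewrite mulrCA; congr (_ * _); rewrite bdU /face_sum raddf_sum /=.
    rewrite (big_fsetD1 l lM) /= big_seq big1 => [|m].
      rewrite addr0 mcoeffZ !mcoeffU; case: (eqVneq M L) => [->|nML].
        by rewrite eqxx.
      case: eqVneq => [E|_]; last by rewrite !mulr0.
      by case/eqP: nML; rewrite -(fsetD1K lM) E fsetD1K.
    (* A facet that drops some [m] other than [l] still contains [l], so it is not the facet of [L]
       opposite [l]. *)
    rewrite !inE => /andP[nml mM]; rewrite mcoeffZ mcoeffU.
    case: eqVneq => [/fsetP/(_ l)|_]; last by rewrite mulr0.
    by rewrite !inE eqxx eq_sym nml lM.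
  exact: H.
move: E; rewrite dz mcoeff0 => /esym/eqP; rewrite mulf_eq0 (negPf zL) orbF.
by rewrite signr_eq0.
Qed.

End Boundary.

(** * Cycles among faces whose members share an extra element *)

Section Cycles.
Variables (q : nat) (le : rel (qset q)).
Hypotheses (le_total : total le) (le_asym : antisymmetric le).
Implicit Types (l m : qset q) (L : {fset qset q}) (A U : {fset nat}) (N : seq nat).

Lemma card_qset l : #|` l| = q. Proof. by case: l => l /= /andP[/eqP]. Qed.

Lemma qset_neq0 l : 0%N \notin (l : {fset nat}).
Proof. by case: l => l /= /andP[]. Qed.

Lemma qset_inj l m : (l : {fset nat}) `<=` m -> l = m.
Proof.
by move=> lm; apply/val_inj/eqP; rewrite /= eqEfcard lm !card_qset leqnn.
Qed.

Lemma ex_qset A : #|` A| = q -> 0%N \notin A -> exists l, qset_val l = A.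
Proof.
move=> cA A0; have h : (#|` A| == q) && (0%N \notin A) by rewrite cA eqxx.
by exists (QSet h).
Qed.

Lemma card_facet U i : #|` U| = q.+1 -> i \in U -> #|` U `\ i| = q.
Proof. by move=> cU iU; apply/eqP; rewrite -eqSS -cU (cardfsD1 i U) iU. Qed.

Lemma ex_fresh A : exists2 i, i != 0%N & i \notin A.
Proof.
exists (\sum_(a <- A) a).+1 => //; apply/negP => h.
by have := big_fsetD1 (op := addn) _ h => /(_ id) /=; lia.
Qed.

Lemma ex_qset_sup A : (#|` A| <= q)%N -> 0%N \notin A ->
  exists l, A `<=` (l : {fset nat}).
Proof.
move=> /subnKC; move: (q - _)%N => d; elim: d A => [|d IH] A cA A0.
  have [||l <-] := @ex_qset A => //; first by rewrite addn0 in cA.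
  by exists l; exact: fsubset_refl.
have [i i0 iA] := ex_fresh A.
have [||l] := IH (i |` A); first by rewrite cardfsU1 iA -cA addSn addnS.
  by rewrite !inE eq_sym negb_or i0.
by rewrite fsubUset => /andP[_ Al]; exists l.
Qed.

(** [all_contain A] is the full simplex on the q-sets containing [A], and [all_contain_some A N] is
    the union of its subsimplices for A + i with i in [N]. The empty face lies in the former always,
    in the latter when [N] is nonempty. *)
Definition all_contain A L := {in L, forall l, A `<=` (l : {fset nat})}.
Definition all_contain_some A N L := exists2 i, i \in N & all_contain (i |` A) L.
Definition interval A U L := forall l, (l \in L) = (A `<=` l) && (l `<=` U).
(** The members of such a face are the sets U - f with f in [U] outside [A]. Once U - f is dropped,
    all the others contain f, so the boundary lies in [all_contain_some A N]. *)
Definition interval_in A N L := exists U,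
  [/\ #|` U| = q.+1, 0%N \notin U, A `<=` U,
      {in U, forall i, (i \in A) || (i \in N)} & interval A U L].

Lemma all_contain_sub A L M : M `<=` L -> all_contain A L -> all_contain A M.
Proof. by move=> /fsubsetP ML AL l /ML/AL. Qed.

Lemma all_containS A B L : A `<=` B -> all_contain B L -> all_contain A L.
Proof. by move=> AB BL l /BL; exact: fsubset_trans. Qed.

Lemma all_contain_some_sub A N L M :
  M `<=` L -> all_contain_some A N L -> all_contain_some A N M.
Proof. by move=> ML [i iN iL]; exists i => //; exact: all_contain_sub iL. Qed.

(* For [N = i :: N'] write a cycle as [x + y], where the faces in [x] have all
   members containing [i |` A] and those in [y] satisfy [all_contain_some A N'].
   Then [bd x = - bd y] falls under the induction hypothesis for [i |` A] and
   [N'], and this reduces the claim to the one for [A] and [N']. *)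
Lemma cycle_bounds N A z :
  uniq N -> 0%N \notin N -> {in N, forall i, i \notin A} -> 0%N \notin A ->
  (#|` A| <= q)%N -> supported (all_contain_some A N) z -> bd le z = 0 ->
  exists2 w, supported (fun L => all_contain_some A N L \/ interval_in A N L) w &
    z = bd le w.
Proof.
elim: N A z => [|i N IH] A z.
  move=> _ _ _ _ _ Nz _; exists 0; first exact: supported0.
  rewrite linear0; apply/malgP => L; rewrite mcoeff0; apply/eqP/negPn/negP.
  by case/Nz.
rewrite cons_uniq inE negb_or => /andP[iN uN] /andP[i0 N0] NA A0.
rewrite leq_eqVlt => /orP[/eqP cA|cA] Nz dz.
  have iA : i \notin A by rewrite NA ?inE ?eqxx.
  have [a aE] := ex_qset cA A0.
  (* Here [A] has q elements, so no q-set contains a larger set and only the empty face can occur.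
     Up to sign it is the boundary of the vertex [A], which is the interval from [A] to A + i;
     nothing is left over, hence the target [False]. *)
  have [|w Pw Qw] := @reduce_supported _ (all_contain_some A (i :: N))
    (fun L => all_contain_some A (i :: N) L \/ interval_in A (i :: N) L)
    (fun=> False) (bd le) z _ Nz.
    move=> L [j jN jL]; have -> : L = fset0.
      apply/eqP/negPn/negP => /fset0Pn[l Ll].
      have := fsubset_leq_card (jL l Ll).
      by rewrite card_qset cardfsU1 NA //= cA ltnn.
    have aa : a \in [fset a] by rewrite inE.
    have [c Hc] := face_bd le aa; rewrite fsetDv in Hc.
    exists (c *: << [fset a] >>).
      apply: supportedZU; right; exists (i |` A); split.
      - by rewrite cardfsU1 iA cA.
      - by rewrite !inE negb_or i0.
      - exact: fsubsetU1.
      - by move=> k; rewrite !inE => /orP[/eqP ->|->]; rewrite ?eqxx ?orbT.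
      - move=> l; rewrite inE -aE; apply/eqP/andP => [->|[al _]].
          by rewrite fsubset_refl fsubsetU1.
        by apply/esym/qset_inj.
    by apply: supported_sub Hc => M [m]; rewrite inE.
  exists w => //; apply/eqP; rewrite -subr_eq0; apply/eqP/malgP => L.
  by rewrite mcoeff0; apply/eqP/negPn/negP => /Qw.
have iA : i \notin A by rewrite NA ?inE ?eqxx.
have [B [cB AB BE inB]] : exists B, [/\ #|` B| = #|` A|.+1, A `<=` B,
    forall X, (B `<=` X) = (i \in X) && (A `<=` X) &
    forall j, (j \in B) = (j == i) || (j \in A)].
  exists (i |` A); split; first by rewrite cardfsU1 iA.
  - exact: fsubsetU1.
  - by move=> X; rewrite fsubUset fsub1set.
  - by move=> j; rewrite !inE.
have {}Nz : supported (fun L => all_contain B L \/ all_contain_some A N L) z.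
  apply: supported_sub Nz => L [j]; rewrite inE => /orP[/eqP -> j_|jN jL].
    by left=> l /j_; rewrite BE fsubUset fsub1set.
  by right; exists j.
have [x [y [Px Py zE]]] := supported_split Nz; rewrite zE in dz *.
have {dz} dy : bd le y = - bd le x.
  by apply/eqP; rewrite -addr_eq0 addrC -linearD dz.
have cAi : (#|` B| <= q)%N by rewrite cB.
have Ai0 : 0%N \notin B by rewrite inB negb_or i0.
have NA' : {in N, forall j, j \notin B}.
  move=> j jN; rewrite inB negb_or NA ?inE ?jN ?orbT // andbT.
  by apply: contraNneq iN => <-.
(* The chain [bd le x] lies in both pieces: its faces have members containing [B] because those of
   [x] do, and their members share an element of [N] because the chain is the negative of
   [bd le y]. *)
have Dx : supported (all_contain_some B N) (bd le x).
  have D1 : supported (all_contain B) (bd le x).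
    apply: supported_linear Px => L PL; apply: supported_bdU => l _.
    by apply: all_contain_sub PL; exact: fsubD1set.
  have D2 : supported (all_contain_some A N) (bd le x).
    have -> : bd le x = - 1 *: bd le y by rewrite dy scaleN1r opprK.
    apply: supportedZ; apply: supported_linear Py => L PL.
    by apply: supported_bdU => l _; apply: all_contain_some_sub PL; exact: fsubD1set.
  move=> L xL; have [j jN jL] := D2 L xL; exists j => // l Ll.
  rewrite fsubUset fsub1set (D1 L xL l Ll) andbT.
  by apply: (fsubsetP (jL l Ll)); exact: fset1U1.
(* All faces of [u], intervals included, consist of q-sets containing [B]. So [x - u] is a cycle of
   a full simplex and bounds there, with any vertex [l] as apex. *)
have [u Pu /eqP xu] := IH B _ uN N0 NA' Ai0 cAi Dx (bd_bd le_total le_asym x).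
have Pxu : supported (all_contain B) (x - u).
  apply: supportedB => //; apply: supported_sub Pu => L [[j _ jL]|].
    by apply: all_containS jL; exact: fsubsetUr.
  by case=> U [_ _ _ _ UL] l; rewrite UL => /andP[].
have [l il] := ex_qset_sup cAi Ai0.
have [v Pv vE] : exists2 v, supported (all_contain B) v & x - u = bd le v.
  apply: (@cone_acyclic _ _ le_total le_asym (fun l : qset q => B `<=` l) l) => //.
  by rewrite linearB (eqP xu) subrr.
(* Adding the vertex U - i to the interval from [B] to [U] gives the interval from [A] to [U].
   Modulo the boundary of the latter, the former becomes a combination of facets that keep U - i and
   miss some U - j with j in [N], so all their members contain j. *)
have [|w Pw Qw] := @reduce_supported _ _ (interval_in A (i :: N))
    (all_contain_some A N) (bd le) u _ Pu.
  move=> L [[j jN jL]|[U [cU U0 AU UN UL]]].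
    exists 0; first exact: supported0.
    rewrite linear0 subr0; apply: supportedU; exists j => //.
    by apply: all_containS jL; exact: fsetUS.
  have iU : i \in U by apply: (fsubsetP AU); rewrite inB eqxx.
  have cUi := card_facet cU iU.
  have [|m mE] := @ex_qset (U `\ i) cUi; first by rewrite !inE negb_and U0 orbT.
  have mL : m \notin L by rewrite UL BE mE in_fsetD1 eqxx.
  have IM : interval A U (m |` L).
    move=> k; rewrite !inE UL; apply/orP/andP => [[/eqP ->|/andP[]]|[Ak kU]].
    - rewrite mE fsubsetD1 iA andbT fsubD1set; split=> //.
      exact: fsubset_trans AB AU.
    - by rewrite BE => /andP[_ ->] ->.
    - have [ik|ik] := boolP (i \in (k : {fset nat})).
        by right; rewrite kU BE ik Ak.
      by left; apply/eqP/qset_inj; rewrite mE fsubsetD1 kU.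
  have mM : m \in m |` L by exact: fset1U1.
  have [c Hc] := face_bd le mM; rewrite fsetU1K // in Hc.
  exists (c *: << m |` L >>).
    apply: supportedZU; exists U; split=> //.
      exact: fsubset_trans AB AU.
    by move=> j /UN; rewrite inB inE; case/orP=> [/orP[]|] ->; rewrite ?orbT.
  apply: supported_sub Hc => M [k] kL ->.
  have := kL; rewrite UL => /andP[Aik kU].
  have /fsubsetPn[j jU jk] : ~~ (U `<=` (k : {fset nat})).
    by apply/negP => /fsubset_leq_card; rewrite cU card_qset ltnn.
  have jAi : j \notin B by apply: contra jk => /(fsubsetP Aik).
  exists j; first by have := UN j jU; rewrite (negPf jAi).
  move=> h; rewrite in_fsetD1 IM => /and3P[hk Ah hU].
  rewrite fsubUset Ah fsub1set andbT; apply: contraR hk => jh; apply/eqP.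
  have cUj := card_facet cU jU.
  have [|g gE] := @ex_qset (U `\ j) cUj; first by rewrite !inE negb_and U0 orbT.
  have -> : h = g by apply: qset_inj; rewrite gE fsubsetD1 hU.
  by symmetry; apply: qset_inj; rewrite gE fsubsetD1 kU.
(* The original cycle is now [bd le v + bd le w] plus this chain, a cycle for [A] and the shorter
   list [N]. *)
have [|||t Pt tE] := IH A (y + (u - bd le w)) uN N0 _ A0 (ltnW cA).
- by move=> j jN; rewrite NA // inE jN orbT.
- exact: supportedD.
- by rewrite linearD linearB (bd_bd le_total le_asym) subr0 dy (eqP xu) addNr.
exists (v + w + t).
  apply: supportedD; first apply: supportedD.
  - apply: (supported_sub _ Pv) => L PL; left; exists i; rewrite ?mem_head // => k /PL.
    by   rewrite BE fsubUset fsub1set.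
  - by apply: supported_sub Pw => L; right.
  - apply: supported_sub Pt => L [[j jN jL]|[U [? ? ? UN ?]]].
      by left; exists j => //; rewrite inE jN orbT.
    right; exists U; split=> // j /UN.
    by rewrite inE => /orP[->|->]; rewrite ?orbT.
rewrite !linearD /= -vE -tE addrACA (addrC _ (u - _)) subrK.
by rewrite addrAC subrK.
Qed.

End Cycles.

(** * Linear combinations modulo boundaries *)

Section Generated.
Variables (R : nzRingType) (V : lmodType R) (d : {linear V -> V}) (G : V -> Prop).

(** This is the spanning clause of [homology_generated_by] for a single element, isolated in order
    to show that it is closed under sums. *)
Definition generated (z : V) := exists (m : nat) (c : 'I_m -> R) (g : 'I_m -> V),
  (forall i, G (g i)) /\ exists w, z = \sum_(i < m) c i *: g i + d w.

Lemma generated_bd w : generated (d w).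
Proof.
exists 0%N, (fun=> 0), (fun=> 0); split; first by case.
by exists w; rewrite big_ord0 add0r.
Qed.

Lemma generated_consG c g z : G g -> generated z -> generated (c *: g + z).
Proof.
move=> Gg [m [c' [g' [Gg' [w ->]]]]].
exists m.+1, (fun i => if unlift ord0 i is Some j then c' j else c),
  (fun i => if unlift ord0 i is Some j then g' j else g); split.
  by move=> i; case: unliftP.
exists w; rewrite big_ord_recl unlift_none addrA; congr (_ + _ + _).
by apply: eq_bigr => i _; rewrite liftK.
Qed.

Lemma generatedD y z : generated y -> generated z -> generated (y + z).
Proof.
move=> [m [c [g [Gg [w ->]]]]] gz; rewrite -addrA.
elim/big_rec: _ => [|i x _ IH]; last by rewrite -addrA; apply: generated_consG.
rewrite add0r; case: gz => [m' [c' [g' [Gg' [w' ->]]]]].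
by exists m', c', g'; split=> //; exists (w + w'); rewrite linearD addrCA.
Qed.

Lemma generated0 : generated 0.
Proof. by rewrite -(linear0 d); exact: generated_bd. Qed.

End Generated.

(** * Basis elements that come from the a_S *)

Section Generators.
Variable q : nat.
Implicit Types (l m : qset q) (L : {fset qset q}) (J U : {fset nat}).

Definition is_generator (x : frakA q) :=
  exists (k : nat) (S : {set kset k (q + k)}),
         [/\ (2 <= k)%N, (q <= k - 1)%N,
             Pgenerator S \/ (#|S| <= 1)%N
           & x = aS S].

Lemma ex_bound (U : {fset nat}) : exists M, forall i, i \in U -> (i <= M)%N.
Proof.
exists (\sum_(a <- U) a)%N => i iU.
by have := big_fsetD1 (op := addn) _ iU => /(_ id) /= ->; exact: leq_addr.
Qed.

Lemma mem_compl_fset n (A : {set 'I_n}) (i : 'I_n) :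
  (i.+1 \in compl_fset A) = (i \notin A).
Proof.
apply/imfsetP/idP => [[j]|iA]; last by exists i; rewrite ?inE.
by rewrite /= inE => jA [/val_inj ->].
Qed.

Lemma compl_fsetK n U : 0%N \notin U -> (forall i, i \in U -> (i <= n)%N) ->
  compl_fset [set i : 'I_n | i.+1 \notin U] = U.
Proof.
move=> U0 Un; apply/fsetP => i; apply/imfsetP/idP => [[j]|iU].
  by rewrite /= !inE negbK => jU ->.
case: i iU => [|i] iU; first by rewrite iU in U0.
by exists (Ordinal (Un _ iU)); rewrite //= !inE negbK.
Qed.

Lemma card_compl_fset n (A : {set 'I_n}) : (#|` compl_fset A| + #|A|)%N = n.
Proof.
rewrite card_imfset /=; last by move=> i j [/val_inj].
by rewrite -cardE addnC cardsC card_ord.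
Qed.

Lemma ex_compl k l : (forall i, i \in (l : {fset nat}) -> (i <= q + k)%N) ->
  exists s : kset k (q + k), compl s = l.
Proof.
move=> lk; pose A := [set i : 'I_(q + k) | i.+1 \notin (l : {fset nat})].
have AE : compl_fset A = l by apply: compl_fsetK => //; exact: qset_neq0.
have cA : #|A| == k.
  by have /eqP := card_compl_fset A; rewrite AE card_qset eqn_add2l.
by exists (KSet cA); apply: val_inj.
Qed.

Lemma compl_inj k : injective (@compl q k).
Proof.
move=> s t /(congr1 (@qset_val q)) /= /fsetP h; apply/val_inj/setP => i.
by have := h i.+1; rewrite !mem_compl_fset => /negb_inj.
Qed.

(** A basis element of the limit comes from every stage k that is large enough to hold its members.
    The parameter [M] lets a caller enlarge k further. *)
Lemma ex_aS L M : exists k (S : {set kset k (q + k)}),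
  [/\ (2 <= k)%N, (q <= k - 1)%N, (M <= k)%N, S = [set s | compl s \in L] &
      [fset compl s | s in S] = L].
Proof.
have [B HB] := ex_bound (\bigcup_(l <- L) (l : {fset nat})).
(* [B] makes the members of [L] fit into [q + k], [M] is the caller's bound, and q + 2 secures the
   two lower bounds on [k]. *)
pose k := (B + M + q + 2)%N.
exists k, [set s | compl s \in L]; split=> //; rewrite /k; try lia.
apply/fsetP => l; apply/imfsetP/idP => [[s]|lL]; first by rewrite /= inE => ? ->.
have [|s sl] := @ex_compl k l; last by exists s; rewrite //= inE sl.
move=> i il; have : (i <= B)%N by apply: HB; apply/bigfcupP; exists l; rewrite ?lL.
rewrite /k; lia.
Qed.

Lemma small_generator L : (#|` L| <= 1)%N -> is_generator << L >>.
Proof.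
move=> L1; have [k [S [k2 qk _ SE LE]]] := ex_aS L 0.
exists k, S; split; rewrite /aS ?LE //; right.
by move: L1; rewrite -LE card_imfset ?cardE //; exact: compl_inj.
Qed.

Lemma interval_generator J U L : #|` U| = q.+1 -> 0%N \notin U -> J `<=` U ->
  (#|` J| < q)%N -> interval J U L -> is_generator << L >>.
Proof.
move=> cU U0 JU cJ LE; have [M UM] := ex_bound U.
have [k [S [k2 qk Mk SE EL]]] := ex_aS L M.
exists k, S; split; rewrite /aS ?EL //; left.
have Uk i : i \in U -> (i <= q + k)%N by move/UM; lia.
have mS s : (s \in S) = (J `<=` compl s) && ((compl s : {fset nat}) `<=` U).
  by rewrite SE inE LE.
(* [facet s f] says that [s] is the complement of U - f; an ordinal stands for its successor, hence
   the shift. *)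
pose facet (s : kset k (q + k)) f := forall i : 'I_(q + k),
  (i \in (s : {set _})) = (i.+1 \notin U) || (i.+1 == f).
have facetE f l (s : kset k (q + k)) :
    f \in U -> compl s = l -> (l : {fset nat}) = U `\ f -> facet s f.
  move=> fU sl lE i; rewrite -[LHS]negbK -mem_compl_fset.
  by rewrite -[compl_fset _]/(compl s : {fset nat}) sl lE !inE negb_and negbK orbC.
have Sfacet s : s \in S -> exists f, [/\ f \in U, f \notin J & facet s f].
  rewrite mS => /andP[Js sU].
  have /fsubsetPn[f fU fs] : ~~ (U `<=` (compl s : {fset nat})).
    by apply/negP => /fsubset_leq_card; rewrite cU card_qset ltnn.
  exists f; split=> //; first by apply: contra fs => /(fsubsetP Js).
  have [|l lE] := @ex_qset q (U `\ f) (card_facet cU fU).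
    by rewrite !inE negb_and U0 orbT.
  apply: (@facetE f (compl s)) => //; rewrite -lE; congr qset_val.
  by apply: qset_inj; rewrite lE fsubsetD1 sU.
have facetS f : f \in U -> f \notin J -> exists2 s, s \in S & facet s f.
  move=> fU fJ; have [|l lE] := @ex_qset q (U `\ f) (card_facet cU fU).
    by rewrite !inE negb_and U0 orbT.
  have [|s sl] := @ex_compl k l.
    by move=> i; rewrite lE !inE => /andP[_ /Uk].
  exists s; last exact: facetE lE.
  by rewrite mS sl lE fsubsetD1 JU fJ fsubD1set.
(* This is where [J] having fewer than q elements matters: [U] has at least two elements outside
   [J], so [S] has at least two members. *)
have other f : exists g, [/\ g \in U, g \notin J & g != f].
  have /fsubsetPn[g gU] : ~~ (U `<=` f |` J).
    apply/negP => /fsubset_leq_card; rewrite cU cardfsU1.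
    by move: cJ; move: #|` J| => c; case: (_ \notin _) => /=; lia.
  by rewrite !inE negb_or => /andP[gf gJ]; exists g.
have facet_inj s f g : f \in U -> g \in U -> facet s f -> facet s g -> f = g.
  move=> fU gU sf sg; case: f fU sf => [|i] fU sf; first by rewrite fU in U0.
  have := sg (Ordinal (Uk _ fU)); rewrite sf /= fU eqxx /=.
  by move/esym/eqP.
(* An element outside [U] lies in every member of [S], hence is not free, while [f] lies in its own
   member only. *)
have freeE s f : s \in S -> f \in U -> facet s f ->
    freeElts S s = [set i : 'I_(q + k) | i.+1 == f]%SET.
  move=> sS fU sf; apply/setP => i; rewrite !inE sf.
  apply/andP/eqP => [[/orP[iU|/eqP //] /forallP H]|iE].
    have [g [gU gJ gf]] := other f; have [t tS tg] := facetS g gU gJ.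
    have := H t; rewrite !inE tS tg iU andbT implybF negbK => /eqP ts.
    by case/eqP: gf; apply: (facet_inj s) => //; rewrite -ts.
  rewrite iE eqxx orbT; split=> //; apply/forallP => t; rewrite !inE.
  apply/implyP => /andP[ts tS]; have [g [gU gJ tg]] := Sfacet t tS.
  rewrite tg iE fU /=; apply: contraNneq ts => fg; rewrite -fg in tg.
  by apply/eqP/val_inj/setP => j; rewrite /= sf tg.
have free_mem s f : s \in S -> f \in U -> facet s f ->
    exists2 i : 'I_(q + k), i.+1 = f & freeElts S s = [set i]%SET.
  move=> sS fU sf; rewrite (freeE s f) //; case: f fU {sf} => [|i] fU.
    by rewrite fU in U0.
  exists (Ordinal (Uk _ fU)) => //; apply/setP => j; rewrite !inE eqSS.
  by apply/eqP/eqP => [?|-> //]; apply: val_inj.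
split; last first.
  move=> s sS; have [f [fU _ sf]] := Sfacet s sS.
  by have [i _ ->] := free_mem s f sS fU sf; rewrite cards1.
pose P := [set i : 'I_(q + k) | i.+1 \notin U]%SET.
have PS : P \subset (\bigcup_(s in S) (s : {set 'I_(q + k)}))%SET.
  (* [0] is a placeholder: any element of [U] outside [J] gives a member of [S], and each member
     contains the complement of [U]. *)
  have [f [fU fJ _]] := other 0%N; have [s sS sf] := facetS f fU fJ.
  by apply/subsetP => i; rewrite inE => iU; apply/bigcupP; exists s; rewrite ?sf ?iU.
exists P.
  split=> //.
  - have := card_compl_fset P; rewrite compl_fsetK // cU; lia.
  - apply/subsetP => i /bigcapP iS; rewrite inE; apply/negP => iU.
    have [g [gU gJ gi]] := other i.+1; have [s sS sg] := facetS g gU gJ.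
    by have := iS s sS; rewrite sg iU /= eq_sym (negPf gi).
  - move=> s sS; have [f [fU _ sf]] := Sfacet s sS.
    have [i iE ->] := free_mem s f sS fU sf; apply/set0Pn; exists i.
    by rewrite !inE eqxx iE fU.
apply/setP => i; rewrite inE; apply/bigcupP/orP => [[s sS]|[iP|/bigcupP[s sS]]].
- have [f [fU _ sf]] := Sfacet s sS; rewrite sf => /orP[iU|iE].
    by left; rewrite inE.
  by right; apply/bigcupP; exists s => //; rewrite (freeE s f) ?inE.
- by apply/bigcupP; apply: (subsetP PS).
- by rewrite inE => /andP[si _]; exists s.
Qed.

End Generators.

(** * Decomposition of the complex by intersection *)

Section Homology.
Variables (q : nat) (le : rel (qset q)).
Hypotheses (le_total : total le) (le_asym : antisymmetric le).
Implicit Types (l m : qset q) (L : {fset qset q}) (J U : {fset nat}).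

(** A free element of [s] is missing from [compl s] but belongs to all other complements, so
    deleting [compl s] enlarges the intersection. If [S] has at most one member, a deletion leaves
    the empty set, which [removable] excludes. *)
Lemma generator_cycle x : is_generator x -> diff le x = 0.
Proof.
move=> [k [S [_ _ HS ->]]]; rewrite diffU /bdiff big_seq_cond.
rewrite big1 // => l /andP[/imfsetP[s /= sS ->]] {l}.
case/andP=> /fset0Pn[m mL] /eqP/fsetP interE; exfalso.
move: (mL); rewrite !inE => /andP[ms /imfsetP[t /= tS mt]].
have ts : t != s by apply: contraNneq ms => <-; rewrite mt.
case: HS => [[_ free1]|]; last first.
  by move/card_le1_eqP => S1; case/eqP: ts; exact: S1.
have /card_gt0P[i] : (0 < #|freeElts S s|)%N by rewrite free1.
rewrite inE => /andP[si /forallP iS].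
have sL : compl s \in [fset compl s | s in S] by apply/imfsetP; exists s.
have := interE i.+1; rewrite (inter_in _ mL) (inter_in _ sL) => E.
have : all (fun m : qset q => i.+1 \in (m : {fset nat})) [fset compl s | s in S].
  rewrite -E; apply/allP => n; rewrite !inE => /andP[ns /imfsetP[u /= uS nu]].
  rewrite nu mem_compl_fset; have := iS u; rewrite !inE uS andbT => /implyP; apply.
  by apply: contraNneq ns => <-; rewrite nu.
by move/allP/(_ _ sL); rewrite mem_compl_fset si.
Qed.

Lemma sub_inter J L : L != fset0 -> (J `<=` inter L) <-> all_contain J L.
Proof.
case/fset0Pn => l0 Ll0; split=> [/fsubsetP JL l Ll|JL].
  by apply/fsubsetP => i /JL; rewrite (inter_in _ Ll0) => /allP/(_ l Ll).
by apply/fsubsetP => i iJ; rewrite (inter_in _ Ll0); apply/allP => l /JL/fsubsetP; apply.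
Qed.

Definition has_inter J L := (L != fset0) && (inter L == J).

(** On the chains of the simplex of q-sets containing [J], this is the passage to the quotient D
    modulo K. The empty face is sent to 0. *)
Definition proj J : {linear frakA q -> frakA q} :=
  linext (fun L => if has_inter J L then << L >> else 0).

Lemma projU J L : proj J << L >> = if has_inter J L then << L >> else 0.
Proof. exact: linextU. Qed.

(** If [L] has intersection [J], a facet keeps it exactly when the deleted vertex is removable.
    Otherwise no facet has intersection [J] either, since the intersection contains [J] and only
    grows under deletion. *)
Lemma proj_bd J z : supported (all_contain J) z -> proj J (bd le z) = diff le (proj J z).
Proof.
apply: (@eq_linear_supported _ _ (all_contain J) (proj J \o bd le) (diff le \o proj J)).
move=> L JL /=; rewrite bdU linear_sum projU /=.
rewrite (eq_bigr (fun l => (-1) ^+ rank le L l *: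
  if has_inter J (L `\ l) then << L `\ l >> else 0 : frakA q)); last first.
  by move=> l _; rewrite linearZ /= projU.
case: ifP => [/andP[L0 /eqP LJ]|LJ].
  rewrite diffU /bdiff [RHS]big_mkcond; apply: eq_bigr => l _.
  by rewrite /removable LJ -/(has_inter _ _); case: ifP; rewrite ?scaler0.
rewrite linear0 big1 // => l _; rewrite ifF ?scaler0 //.
apply: contraFF LJ => /andP[L10 /eqP L1J].
have L0 : L != fset0 by apply: contraNneq L10 => ->; rewrite fset0D.
rewrite /has_inter L0 eqEfsubset /=; apply/andP; split.
  by have := interS L10 (fsubD1set L l); rewrite L1J.
exact/(sub_inter J L0).
Qed.

Lemma proj_diff J z : proj J (diff le z) = diff le (proj J z).
Proof.
apply: (@eq_linear_supported _ _ (fun=> True)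
  (proj J \o diff le) (diff le \o proj J) z _ (@supportedT _ z)) => L _ /=.
rewrite diffU linear_sum projU /=.
rewrite (eq_bigr (fun l => (-1) ^+ pos le L l *:
  if has_inter J L then << L `\ l >> else 0 : frakA q)); last first.
  move=> l /andP[L1 /eqP E]; rewrite linearZ /= projU /has_inter E L1.
  suff -> : L != fset0 by [].
  by apply: contraNneq L1 => ->; rewrite fset0D.
case: ifP => _; first by rewrite diffU.
by rewrite linear0 big1 // => l _; rewrite scaler0.
Qed.

Lemma mcoeff_proj J L z : (proj J z)@_L = if has_inter J L then z@_L else 0.
Proof.
have := @supportedT _ z; elim/supported_ind => [|c M y _ IH].
  by rewrite linear0 mcoeff0 if_same.
rewrite (linearP (proj J)) projU 2!mcoeffD IH 2!mcoeffZ.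
have [<-|ML] := eqVneq M L; first by case: ifP; rewrite // mcoeff0 mulr0 addr0.
rewrite [<< M >>@_L]mcoeffU (negPf ML) mulr0 add0r.
by case: ifP => _; rewrite ?mcoeffU ?(negPf ML) ?mcoeff0 mulr0 add0r.
Qed.

Lemma proj_sum z : exists (c : rat) (Js : {fset {fset nat}}),
  z = c *: << fset0 >> + \sum_(J <- Js) proj J z.
Proof.
(* Only the intersections of the nonempty faces of [z] matter. The empty face is killed by every
   [proj J] and is kept apart. *)
exists z@_fset0, [fset inter L | L in [fset L in msupp z | L != fset0]].
apply/malgP => L; rewrite mcoeffD mcoeffZ mcoeffU raddf_sum /=.
have [->|L0] := eqVneq L fset0.
  rewrite mulr1 big1 ?addr0 // => J _.
  by rewrite mcoeff_proj /has_inter eqxx.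
rewrite mulr0 add0r; have [zL|zL] := boolP (L \in msupp z); last first.
  rewrite (mcoeff_outdom zL) big1 // => J _.
  by rewrite mcoeff_proj (mcoeff_outdom zL) if_same.
rewrite (big_fsetD1 (inter L)) /=; last first.
  by apply/imfsetP; exists L; rewrite // !inE zL.
rewrite big_seq big1 => [|J].
  by rewrite addr0 mcoeff_proj /has_inter L0 eqxx.
rewrite in_fsetD1 mcoeff_proj /has_inter (eq_sym (inter L)) => /andP[/negPf -> _].
by rewrite andbF.
Qed.

Lemma generated_component J z : supported (has_inter J) z -> diff le z = 0 ->
  generated (diff le) (@is_generator q) z.
Proof.
move=> zJ dz.
have [z0|] := eqVneq (msupp z) fset0.
  by rewrite [z]monalgE z0 big_seq_fset0; exact: generated0.
case/fset0Pn=> L0; rewrite -mcoeff_neq0 => /zJ /andP[L0n /eqP L0J].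
have zo : supported (all_contain J) z.
  by apply: supported_sub zJ => L /andP[Ln /eqP LJ]; apply/(sub_inter J Ln); rewrite LJ.
have /fset0Pn[l0 l0L] := L0n.
have Jl0 : J `<=` (l0 : {fset nat}).
  by have /(sub_inter J L0n) : J `<=` inter L0; [rewrite L0J|apply].
have J0 : 0%N \notin J by apply: contra (qset_neq0 l0) => /(fsubsetP Jl0).
have := fsubset_leq_card Jl0; rewrite card_qset leq_eqVlt => /orP[/eqP cJ|cJ].
  (* [J] has q elements, so the only nonempty face above it is the singleton of [J]. *)
  move: zJ; elim/supported_ind => [|c L y /andP[Ln /eqP LJ]]; first exact: generated0.
  apply: generated_consG; apply: small_generator.
  have Ll l : l \in L -> J = l.
    move=> lL; have Jl : J `<=` (l : {fset nat}).
      by have /(sub_inter J Ln) : J `<=` inter L; [rewrite LJ|apply].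
    by apply/eqP; rewrite eqEfcard Jl cJ card_qset leqnn.
  have /fset0Pn[l lL] := Ln.
  suff -> : L = [fset l] by rewrite cardfs1.
  apply/fsetP => k; rewrite inE; apply/idP/eqP => [kL|-> //].
  by apply: val_inj; rewrite /= -(Ll k kL) -(Ll l lL).
pose W := \bigcup_(L <- msupp z) \bigcup_(l <- L) (l : {fset nat}).
pose N : seq nat := [fset i in W `|` l0 | (i \notin J) && (i != 0%N)].
have NP i : (i \in N) = [&& (i \in W) || (i \in (l0 : {fset nat})), i \notin J & i != 0%N].
  by rewrite !inE.
(* As [diff le z] vanishes, [bd le z] has no face with intersection exactly [J], so the members of
   each nonempty face share a further element, found in [W]. For the empty face any element of [N]
   will do, and [l0] provides one. *)
have dzN : supported (all_contain_some J N) (bd le z).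
  have D1 : supported (all_contain J) (bd le z).
    apply: supported_linear zo => L JL; apply: supported_bdU => l _.
    by apply: all_contain_sub JL; exact: fsubD1set.
  have D2 : supported (fun L => {in L, forall l, (l : {fset nat}) `<=` W}) (bd le z).
    apply: (@supported_linear _ (fun L => L \in msupp z)).
      move=> L Lz; apply: supported_bdU => l _ k; rewrite !inE => /andP[_ kL].
      apply: (fsubset_trans _ (bigfcup_sup _ Lz isT)).
      exact: (bigfcup_sup _ kL).
    by move=> L; rewrite mcoeff_neq0.
  move=> L dL; have JL := D1 L dL; have LW := D2 L dL.
  have /fsubsetPn[i il0 iJ] : ~~ ((l0 : {fset nat}) `<=` J).
    by apply/negP => /fsubset_leq_card; rewrite card_qset leqNgt cJ.
  have [LE|Ln] := eqVneq L fset0.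
    exists i; last by rewrite LE.
    by rewrite NP il0 orbT iJ; apply: contraNneq (qset_neq0 l0) => <-.
  have LJ : inter L != J.
    apply: contraNneq dL => LJ; have := proj_bd zo.
    have -> : proj J z = z.
      apply/malgP => M; rewrite mcoeff_proj; case: ifP => // MJ.
      by apply/esym/eqP/negPn/negP => /zJ; rewrite MJ.
    rewrite dz => /(congr1 (mcoeff L)).
    by rewrite mcoeff_proj mcoeff0 /has_inter Ln LJ eqxx /= => ->.
  have JiL : J `<=` inter L by apply/(sub_inter J Ln).
  have /fsubsetPn[j jL jJ] : ~~ (inter L `<=` J).
    by apply: contra LJ => iLJ; rewrite eqEfsubset iLJ.
  have /fset0Pn[k kL] := Ln.
  have jin l : l \in L -> j \in (l : {fset nat}).
    by move: jL; rewrite (inter_in _ kL) => /allP h /h.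
  exists j => [|l lL]; last by rewrite fsubUset fsub1set jin ?JL.
  rewrite NP jJ (fsubsetP (LW k kL) j (jin k kL)) /=.
  by apply: contraNneq (qset_neq0 k) => <-; exact: jin.
(* [u] fills [bd le z] inside K and the adjoined intervals. Then [z - u] is a cycle of the
   contractible simplex D, hence some [bd le v], and applying [proj J] gives [z] as [proj J u] plus
   a boundary. *)
have [|||u Pu /eqP zu] := cycle_bounds le_total le_asym _ _ _ J0 (ltnW cJ) dzN
  (bd_bd le_total le_asym z).
- exact: fset_uniq.
- by rewrite NP eqxx !andbF.
- by move=> i; rewrite NP => /and3P[].
have Puo : supported (all_contain J) u.
  apply: supported_sub Pu => L [[j _ jL]|[U [_ _ _ _ UL]] l].
    by apply: all_containS jL; exact: fsubsetUr.
  by rewrite UL => /andP[].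
have Pzu : supported (all_contain J) (z - u) by apply: supportedB.
have [v Pv vE] : exists2 v, supported (all_contain J) v & z - u = bd le v.
  apply: (@cone_acyclic _ _ le_total le_asym (fun l : qset q => J `<=` l) l0 _ Jl0 Pzu).
  by rewrite linearB (eqP zu) subrr.
have zE : z = proj J u + diff le (proj J v).
  rewrite -proj_bd // -vE -linearD addrC subrK; apply/malgP => M.
  rewrite mcoeff_proj; case: ifP => // MJ.
  by apply/eqP/negPn/negP => /zJ; rewrite MJ.
rewrite zE; apply: generatedD; last exact: generated_bd.
elim/supported_ind: Pu => [|c L y LP IH]; first by rewrite linear0; exact: generated0.
rewrite linearP projU; case: ifP => [/andP[Ln /eqP LJ]|_]; last first.
  by rewrite scaler0 add0r.
(* A face of [u] in K has an intersection larger than [J], so only intervals survive the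
   projection. *)
apply: generated_consG => //; case: LP => [[j jN jL]|[U [cU U0 JU _ UL]]].
  move/(sub_inter (j |` J) Ln): jL; rewrite LJ fsubUset fsub1set.
  by move: jN; rewrite NP => /and3P[_ /negPf ->].
exact: interval_generator UL.
Qed.

End Homology.

Theorem theorem4p6 (q : nat) (le : rel (qset q))
    (le_total : total le) (le_asym : antisymmetric le)
    (le_trans : transitive le) :
  homology_generated_by (@diff q le)
    (fun x : frakA q =>
       exists (k : nat) (S : {set kset k (q + k)}),
         [/\ (2 <= k)%N, (q <= k - 1)%N,
             Pgenerator S \/ (#|S| <= 1)%N
           & x = aS S]).
Proof.
split=> [x Gx|z dz]; first exact: (generator_cycle le Gx).
have [c [Js zE]] := proj_sum z.
change (generated (diff le) (@is_generator q) z).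
(* The empty face is a degenerate generator; each [proj J z] is a cycle, because the projections
   commute with the differential. *)
rewrite [z]zE; apply: generated_consG; first by apply: small_generator; rewrite cardfs0.
rewrite big_seq; elim/big_rec: _ => [|J y JJ IH]; first exact: generated0.
apply: generatedD IH; apply: (generated_component le_total le_asym (J := J)).
  by move=> L; rewrite mcoeff_proj; case: ifP => //; rewrite eqxx.
by rewrite -proj_diff dz linear0.
Qed.
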